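(* Let $X$ and $Y$ be diffeological spaces, and suppose that $\phi:X\rightarrow\mathfrak{P}_{u}(Y)$ is a smooth set-valued map. Then $\phi$ is lower semi-continuous with respect to the D-topology; that is, for every D-open subset $O\subset Y$, the set $\{x\in X\mid \phi(x)\cap O\neq\emptyset\}$ is D-open in $X$.
   Context: A parametrization in a set $X$ is a map $P:U\to X$ with $U$ an open subset of some $\mathbb{R}^n$. A diffeology on $X$ is a set of parametrizations in $X$ (called plots) that contains all constant parametrizations, is local, and is stable under precomposition with smooth maps between open subsets of Euclidean spaces. A map $f$ between diffeological spaces is smooth if $f\circ P$ is a plot for every plot $P$. A subset of a diffeological space is D-open if its preimage under every plot is open; the D-open sets form the D-topology. $\mathfrak{P}(Y)$ is the set of all subsets of $Y$. Union power set diffeology: $P:U\to\mathfrak{P}(Y)$ is a plot of $\mathfrak{P}_u(Y)$ iff there is a family of parametrizations $P_i:U_i\to\mathfrak{P}(Y)$ ($i\in J$, $U_i$ open in the same Euclidean space, $U=\bigcup_i U_i$), each either constant with value $\emptyset$ or of the form $r\mapsto\{p_i(r)\}$ for a plot $p_i:U_i\to Y$, such that $P(r)=\bigcup\{P_i(r)\mid i\in J,\ r\in U_i\}$ for all $r\in U$. Equivalently: for every $r_0\in U$ and $y_0\in P(r_0)$ there exist an open neighborhood $V\subset U$ of $r_0$ and a plot $\sigma:V\to Y$ with $\sigma(r)\in P(r)$ for all $r\in V$ and $\sigma(r_0)=y_0$. *)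

(* Defs.v *)
From HB Require Import structures.
From mathcomp Require Import all_boot all_order all_algebra.
From mathcomp Require Import boolp classical_sets functions reals.
From mathcomp Require Import topology normedtype derive.

Set Implicit Arguments.
Unset Strict Implicit.
Unset Printing Implicit Defensive.

Import Order.TTheory GRing.Theory Num.Theory.
Import numFieldNormedType.Exports.

Local Open Scope classical_set_scope.
Local Open Scope ring_scope.

(* [Ck k V g]: g is of class C^k on the (open) set V; the values of g outside
   V are irrelevant.  In finite dimension, continuity of the differential is
   the same as continuity of all the directional derivatives. *)
Fixpoint Ck (R : realType) (m n k : nat) (V : set 'rV[R]_m)
    (g : 'rV[R]_m -> 'rV[R]_n) : Prop :=
  match k with
  | 0 => forall x, V x -> {for x, continuous g}
  | k'.+1 => (forall x, V x -> differentiable g x) /\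
             (forall v, Ck k' V (fun x => 'D_v g x))
  end.

(* The extension g is only there to apply 'D_v, which needs a function on the
   whole space: as V is open, its choice is immaterial. *)
Definition smooth_between (R : realType) (m n : nat)
    (V : set 'rV[R]_m) (U : set 'rV[R]_n) (f : V -> U) : Prop :=
  exists2 g : 'rV[R]_m -> 'rV[R]_n,
    (forall k, Ck k V g) & (forall r : V, g (val r) = val (f r)).

Definition set_incl (T : Type) (A B : set T) (AB : A `<=` B) (x : A) : B :=
  exist _ (val x) (mem_set (AB _ (set_valP x))).

Record parametrization (R : realType) (X : Type) (n : nat) := Parametrization {
  dom : set 'rV[R]_n;
  dom_open : open dom;
  pmap :> dom -> X }.
Arguments dom_open {R X n} p _ _.
Arguments pmap {R X n} p _.

Section parametrization_ops.
Context {R : realType} {X : Type} {n : nat}.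

Definition cst_param (U : set 'rV[R]_n) (Uo : open U) (x : X) :
    parametrization R X n :=
  Parametrization Uo (fun=> x).

Definition comp_param (P : parametrization R X n) {m : nat}
    (V : set 'rV[R]_m) (Vo : open V) (f : V -> dom P) :
    parametrization R X m :=
  Parametrization Vo (P \o f).

Definition restr_param (P : parametrization R X n)
    (V : set 'rV[R]_n) (Vo : open V) (VP : V `<=` dom P) :
    parametrization R X n :=
  Parametrization Vo (P \o set_incl VP).

Definition map_param (Z : Type) (f : X -> Z) (P : parametrization R X n) :
    parametrization R Z n :=
  Parametrization (dom_open P) (f \o P).

End parametrization_ops.

HB.mixin Record isDiffeological (R : realType) (X : Type) := {
  plot : forall n : nat, set (parametrization R X n);
  plot_cst : forall n (U : set 'rV[R]_n) (Uo : open U) (x : X),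
    plot n (cst_param Uo x);
  plot_local : forall n (P : parametrization R X n),
    (forall r : dom P,
       exists (V : set 'rV[R]_n) (Vo : open V) (VP : V `<=` dom P),
         V (val r) /\ plot n (restr_param Vo VP)) ->
    plot n P;
  plot_smooth : forall n m (P : parametrization R X n)
      (V : set 'rV[R]_m) (Vo : open V) (f : V -> dom P),
    plot n P -> smooth_between f -> plot m (comp_param Vo f) }.

#[short(type="diffeologicalType")]
HB.structure Definition Diffeological (R : realType) :=
  { X of isDiffeological R X }.
Arguments plot {R X n} _ : rename.
Arguments plot_cst {R X n U} Uo x : rename.
Arguments plot_local {R X n} P _ : rename.
Arguments plot_smooth {R X n m P V} Vo f _ _ : rename.

Definition diff_smooth (R : realType) (X Y : diffeologicalType R)
    (f : X -> Y) : Prop :=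
  forall n (P : parametrization R X n), plot P -> plot (map_param f P).

(* [dom P] carries the subspace topology of the Euclidean space. *)
Definition D_open (R : realType) (X : diffeologicalType R) (A : set X) : Prop :=
  forall n (P : parametrization R X n), plot P -> open (P @^-1` A).


Lemma Ck_cst (R : realType) (m n k : nat) (V : set 'rV[R]_m) (c : 'rV[R]_n) :
  Ck k V (fun=> c).
Proof.
elim: k c => [|k IH] c /=; first by move=> x _; exact: cst_continuous.
split=> [x _|v]; first exact: differentiable_cst.
have -> : (fun x : 'rV[R]_m => 'D_v (fun=> c) x) = fun=> 0 by
  apply/funext => x; exact: derive_cst.
exact: IH.
Qed.

Lemma Ck_id (R : realType) (m k : nat) (V : set 'rV[R]_m) : Ck k V id.
Proof.
case: k => [|k] /=; first by move=> x _; exact: cvg_id.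
split=> [x _|v]; first exact: ex_diff.
have -> : (fun x : 'rV[R]_m => 'D_v id x) = fun=> v by
  apply/funext => x; exact: derive_id.
exact: Ck_cst.
Qed.

Lemma Ck_subset (R : realType) (m n k : nat) (V W : set 'rV[R]_m)
    (g : 'rV[R]_m -> 'rV[R]_n) :
  W `<=` V -> Ck k V g -> Ck k W g.
Proof.
move=> WV; elim: k g => [|k IH] g /=; first by move=> Vg x /WV /Vg.
by case=> dg Dg; split=> [x /WV /dg //|v]; exact/IH/Dg.
Qed.

Lemma smooth_set_incl (R : realType) (n : nat) (V U : set 'rV[R]_n)
  (VU : V `<=` U) : smooth_between (set_incl VU).
Proof. by exists id => // k; exact: Ck_id. Qed.

Section union_power_set_diffeology.
Context {R : realType} (Y : diffeologicalType R).

Definition upowerset : Type := set Y.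

Definition elementary n (Q : parametrization R (set Y) n) : Prop :=
  (forall r, Q r = set0) \/
  (exists2 p : dom Q -> Y,
     plot (Parametrization (dom_open Q) p) & forall r, Q r = [set p r]).

Definition is_union_of n (P : parametrization R (set Y) n) (J : Type)
    (Q : J -> parametrization R (set Y) n) : Prop :=
  dom P = \bigcup_i dom (Q i) /\
  forall r : dom P,
    P r = [set y | exists i (s : dom (Q i)), val s = val r /\ Q i s y].

Definition uplot n (P : parametrization R upowerset n) : Prop :=
  exists (J : Type) (Q : J -> parametrization R (set Y) n),
    (forall i, elementary (Q i)) /\ is_union_of P Q.

Lemma uplotP n (P : parametrization R upowerset n) :
  uplot P <->
  forall (r0 : dom P) (y0 : Y), P r0 y0 ->
    exists (V : set 'rV[R]_n) (Vo : open V) (VP : V `<=` dom P) (sigma : V -> Y),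
      [/\ plot (Parametrization Vo sigma),
          forall r, P (set_incl VP r) (sigma r) &
          exists2 r : V, val r = val r0 & sigma r = y0].
Proof.
split=> [[J [Q [Qe [dP PE]]]] r0 y0|Ploc].
  rewrite PE => -[i [s [sr Qy]]].
  case: (Qe i) => [Q0|[p pp Qp]]; first by move: Qy; rewrite Q0.
  have VP : dom (Q i) `<=` dom P by rewrite dP => x Qx; exists i.
  exists (dom (Q i)), (dom_open (Q i)), VP, p; split=> // [r|].
    by rewrite PE; exists i, r; split=> //; rewrite Qp.
  by exists s => //; move: Qy; rewrite Qp.
pose section (T : parametrization R Y n) := plot T /\
  exists VP : dom T `<=` dom P, forall r, P (set_incl VP r) (T r).
pose Q (i : option {T | section T}) : parametrization R (set Y) n :=
  if i is Some T then map_param (fun y => [set y]) (sval T)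
  else cst_param (dom_open P) set0.
exists _, Q; split=> [[[T [pT sT]]|]|]; [right|by left|].
  by exists (pmap T) => //=; case: T pT {sT}.
split=> [|r].
  rewrite eqEsubset; split=> [x Px|x [[[T [pT [VP sT]]]|] _ //=]].
    by exists None.
  exact: VP.
apply/seteqP; split=> [y Py|y [[[T [pT [VP sT]]]|] [s [sr]]]] //=.
  have [V [Vo [VP [sigma [ps sP [s sr sy]]]]]] := Ploc r y Py.
  have sec : section (Parametrization Vo sigma) by split=> //; exists VP.
  by exists (Some (exist _ _ sec)), s; split=> //=.
move=> ->; rewrite (_ : r = set_incl VP s); first exact: sT.
exact/val_inj.
Qed.

Lemma uplot_cst n (U : set 'rV[R]_n) (Uo : open U) (A : upowerset) :
  uplot (cst_param Uo A).
Proof.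
apply/uplotP => r y Ay.
exists U, Uo, (@subset_refl _ U), (fun=> y); split=> //.
  exact: (plot_cst Uo y).
by exists r.
Qed.

Lemma uplot_local n (P : parametrization R upowerset n) :
  (forall r : dom P,
     exists (V : set 'rV[R]_n) (Vo : open V) (VP : V `<=` dom P),
       V (val r) /\ uplot (restr_param Vo VP)) ->
  uplot P.
Proof.
move=> Ploc; apply/uplotP => r y Py.
have [V [Vo [VP [Vr /uplotP]]]] := Ploc r.
pose r' : V := exist _ (val r) (mem_set Vr).
have rr' : set_incl VP r' = r by exact/val_inj.
move=> /(_ r' y); rewrite /= rr' => /(_ Py).
move=> [W [Wo [WV [sigma [ps sP [s sr sy]]]]]].
exists W, Wo, (subset_trans WV VP), sigma; split=> //; last by exists s.
move=> t; rewrite (_ : set_incl _ t = set_incl VP (set_incl WV t)).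
  exact: sP.
exact/val_inj.
Qed.

Lemma uplot_smooth n m (P : parametrization R upowerset n)
    (V : set 'rV[R]_m) (Vo : open V) (f : V -> dom P) :
  uplot P -> smooth_between f -> uplot (comp_param Vo f).
Proof.
move=> /uplotP Pu [g gC gf]; apply/uplotP => r y /= Py.
have [W [Wo [WP [sigma [ps sP [s sr sy]]]]]] := Pu _ _ Py.
pose V' := V `&` g @^-1` W.
have V'o : open V'.
  rewrite openE => x [Vx Wx]; apply: filterI; first exact: open_nbhs_nbhs.
  by apply: (gC 0%N x Vx); exact: open_nbhs_nbhs.
have V'V : V' `<=` V by move=> x [].
have V'W (t : V') : W (g (val t)) by have [] := set_valP t.
pose h (t : V') : W := exist _ (g (val t)) (mem_set (V'W t)).
exists V', V'o, V'V, (sigma \o h); split.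
- apply: (plot_smooth (P := Parametrization Wo sigma) V'o h ps).
  by exists g => // k; exact: Ck_subset (gC k).
- move=> t /=; rewrite (_ : f _ = set_incl WP (h t)); first exact: sP.
  by apply/val_inj => /=; rewrite -gf.
- have V'r : V' (val r).
    by split; [exact: set_valP|rewrite /= gf -sr; exact: set_valP].
  exists (exist _ (val r) (mem_set V'r)) => //=.
  by rewrite -sy; congr sigma; apply/val_inj; rewrite /= gf sr.
Qed.

HB.instance Definition _ :=
  isDiffeological.Build R upowerset uplot_cst uplot_local uplot_smooth.

End union_power_set_diffeology.

(* Main.v *)
(* A point y of phi (P r) in O extends to a plot sigma through y, on a
   neighbourhood of r, with values in phi (P _).  Since O is D-open, sigma
   stays in O near r, so phi (P _) meets O near r. *)
Require Import Defs.
From mathcomp Require Import all_boot all_order all_algebra.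
From mathcomp Require Import boolp classical_sets functions reals.
From mathcomp Require Import topology normedtype derive.

Local Open Scope classical_set_scope.

(** Local selections give lower semi-continuity: [uplotP], applied to the plot [phi \o P], provides
    the plot [sigma] through a given point of [phi (P r)]. *)

Theorem theorem3p7 (R : realType) (X Y : diffeologicalType R)
    (phi : X -> upowerset Y) (phi_smooth : diff_smooth phi) :
  forall O : set Y, D_open O -> D_open [set x : X | phi x `&` O !=set0].
Proof.
move=> O Oo n P pP.
have /uplotP Ploc : uplot (map_param phi P) := phi_smooth n P pP.
rewrite openE => r [y [phiy Oy]].
have [V [Vo [VP [sigma [psigma sigmaP [s sr sy]]]]]] := Ploc r y phiy.
(* The preimage of [O] under [sigma] is open only in the subspace [V]: it is the trace on [V] of a
   Euclidean open set [W]. *)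
have [W Wo WE] := Oo n _ psigma.
have Ws : W (val s).
  suff : (val @^-1` W) s by [].
  by rewrite WE /= sy.
(* Since [V] is itself open in the Euclidean space, [V] and [W] meet in an open set, whose trace on
   the domain of [P] is the required neighbourhood of [r]. *)
exists (val @^-1` (V `&` W)); split.
- by exists (V `&` W) => //; exact: openI.
- by rewrite /= -sr; split=> //; exact: set_valP.
move=> t [Vt Wt].
pose t' : V := exist _ (val t) (mem_set Vt).
have tt' : set_incl VP t' = t by exact/val_inj.
exists (sigma t'); split; first by have := sigmaP t'; rewrite /= tt'.
suff : (val @^-1` W) t' by rewrite WE.
by [].
Qed.
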